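(* Let $n\ge 1$ and let $K$ be a field such that $p:=\operatorname{char}K=0$ or $p=\operatorname{char}K\ge n$. Suppose that $K\not\cong\mathbb F_p$ in the case where $p\in\{n,n+1\}$. Take $a=1$ if $p\notin\{n,n+1\}$, and take $a\in K\setminus\mathbb F_p$ if $p\in\{n,n+1\}$. Then the subspace $$\mathcal M:=\big\{M\in\operatorname{Mat}_n(K)\ \big|\ M_{n1}=M_{n2}=\cdots=M_{n(n-1)}=0=\operatorname{tr}M+aM_{nn}\big\}$$ of $\operatorname{Mat}_n(K)$ is a two-sided Mathieu subspace of $\operatorname{Mat}_n(K)$.
   Context: $\operatorname{Mat}_n(K)$ is the $K$-algebra of $n\times n$ matrices over $K$; $M_{ij}$ denotes the $(i,j)$ entry of $M$; $\mathbb F_p$ is regarded as the prime subfield of $K$ when $p>0$. A $K$-subspace $\mathcal M$ of $\operatorname{Mat}_n(K)$ is a two-sided Mathieu subspace if for all $a,b,c\in\operatorname{Mat}_n(K)$ such that $a^m\in\mathcal M$ for all $m\ge 1$, one has $ba^mc\in\mathcal M$ for all sufficiently large $m$. *)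

(* Defs.v *)
From HB Require Import structures.
From mathcomp Require Import all_boot all_order all_algebra.

Set Implicit Arguments.
Unset Strict Implicit.
Unset Printing Implicit Defensive.

Import GRing.Theory.
Local Open Scope ring_scope.

(* [pchar K] only records prime characteristics: it is empty when char K = 0. *)
Definition has_char (K : fieldType) (p : nat) : Prop :=
  (p = 0%N /\ [pchar K] =i pred0) \/ p \in [pchar K].

Definition field_isomorphic (K L : fieldType) : Prop :=
  exists f : {rmorphism K -> L}, bijective f.

(* The image of 'F_p in K under the canonical embedding. This is the prime
   subfield when p is the (positive) characteristic of K; it is meaningful
   only in that case. *)
Definition in_prime_subfield (K : fieldType) (p : nat) (x : K) : Prop :=
  exists y : 'F_p, x = (y : nat)%:R.

Definition two_sided_mathieu_subspace
    (K : fieldType) (A : algType K) (S : {pred A}) : Prop :=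
  submod_closed S /\
  forall a b c : A,
    (forall m : nat, (1 <= m)%N -> a ^+ m \in S) ->
    exists N : nat, forall m : nat, (N <= m)%N -> b * a ^+ m * c \in S.

(* Matrices of size n.+1, so that the last index is ord_max. *)
Definition last_row_trace_space
    (K : fieldType) (n : nat) (a : K) : {pred 'M[K]_n.+1} :=
  [pred M : 'M[K]_n.+1 |
    [forall j : 'I_n.+1, (j != ord_max) ==> (M ord_max j == 0)]
    && (\tr M + a * M ord_max ord_max == 0)].
Arguments last_row_trace_space {K} n a.

(* Main.v *)
Require Import Defs.
From HB Require Import structures.
From mathcomp Require Import all_boot all_order all_algebra.

Set Implicit Arguments.
Unset Strict Implicit.
Unset Printing Implicit Defensive.

Import GRing.Theory.
Local Open Scope ring_scope.

(** If every positive power of A lies in M, then so does every q(A) with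
    q(0) = 0, in particular the Fitting idempotent e of A, which satisfies
    A^k = A^k e for some k.  The trace of e is its rank r, and e_nn is 0 or 1.
    If e_nn = 0, then r < n and r = 0 in K, so e = 0.  If e_nn = 1, then
    r + a = 0 in K with 1 <= r <= n, which the choice of a excludes.  Hence
    e = 0 and A is nilpotent. *)

Lemma submod_horner_mx (K : fieldType) (n : nat) (S : {pred 'M[K]_n.+1})
    (A : 'M[K]_n.+1) (q : {poly K}) :
  submod_closed S -> (forall m, (1 <= m)%N -> A ^+ m \in S) ->
  horner_mx A (q * 'X) \in S.
Proof.
move=> [S0 SZD] SA.
(* The factor ['X] turns each monomial of [q] into one of degree [i.+1], so only positive powers of
   [A] occur. *)
rewrite -[q]coefK poly_def mulr_suml rmorph_sum /=.
apply: (big_ind (fun M => M \in S)) => // [M N SM SN|i _].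
  by rewrite -[M]scale1r; apply: SZD.
rewrite -scalerAl -exprSr linearZ /= rmorphXn /= horner_mx_X -[_ *: _]addr0.
exact/SZD/S0/SA.
Qed.

(** Write the characteristic polynomial as [g * 'X^k] with [g] prime to ['X], and take
    [u * 'X^(k.+1) + v * g = 1]. Then [e] is the value of [u * 'X^(k.+1)] at [A], and
    Cayley-Hamilton kills both [e * (1 - e)] and [A ^+ k * (1 - e)]. The exponent [k.+1] keeps the
    constant term zero even if [k = 0]. *)
Lemma fitting_idempotent (K : fieldType) (n : nat) (A : 'M[K]_n.+1) :
  exists q k, let e := horner_mx A (q * 'X) in
    e * e = e /\ A ^+ k * e = A ^+ k.
Proof.
have [k [g g0 defA]] := multiplicity_XsubC (char_poly A) 0.
move: g0 defA; rewrite monic_neq0 ?char_poly_monic //= subr0 => g0 defA.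
have /Bezout_eq1_coprimepP[[u v] /= uv1] : coprimep 'X^(k.+1) g.
  by apply: coprimep_expl; rewrite coprimep_sym coprimepX.
have chA0 : horner_mx A (g * 'X^k) = 0 by rewrite -defA Cayley_Hamilton.
exists (u * 'X^k), k => /=; rewrite -mulrA -exprSr.
have eE : u * 'X^(k.+1) = 1 - v * g by rewrite -uv1 addrK.
split.
  rewrite -rmorphM /= {2}eE mulrBr mulr1 rmorphB /=.
  suff -> : u * 'X^(k.+1) * (v * g) = (u * v * 'X) * (g * 'X^k).
    by rewrite [X in _ - X]rmorphM /= chA0 mulr0 subr0.
  by rewrite exprS mulrACA -!mulrA (mulrC g).
have -> : A ^+ k = horner_mx A 'X^k by rewrite rmorphXn /= horner_mx_X.
rewrite -rmorphM /= eE mulrBr mulr1 mulrCA (mulrC _ g).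
by rewrite rmorphB rmorphM /= chA0 mulr0 subr0.
Qed.

(** In a full-rank factorization [e = C *m R], cancelling [C] on the left and [R] on the right of
    [C R C R = C R] gives [R *m C = 1], of size the rank. *)
Lemma mxtrace_idempotent (K : fieldType) (n : nat) (e : 'M[K]_n) :
  e *m e = e -> \tr e = (\rank e)%:R.
Proof.
move=> ee; rewrite -{1}[e]mulmx_base mxtrace_mulC.
suff -> : row_base e *m col_base e = 1%:M by rewrite mxtrace1.
apply: (row_full_inj (col_base_full e)); apply: (row_free_inj (row_base_free e)).
by rewrite /= mulmx1 mulmxA mulmx_base -mulmxA mulmx_base.
Qed.

Lemma has_char_natr_eq0 (K : fieldType) (p m : nat) :
  has_char K p -> p = 0%N \/ (m < p)%N -> (m%:R == 0 :> K) = (m == 0%N).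
Proof.
case=> [[_ /pcharf0P ch0] _ | chp]; first exact: ch0.
rewrite -(dvdn_pcharf chp) => -[p0|ltmp].
  by have := pcharf_prime chp; rewrite p0.
by case: m ltmp => [|m] ltmp; rewrite ?dvdn0 // gtnNdvd.
Qed.

Lemma in_prime_subfield_oppr_nat (K : fieldType) (p m : nat) :
  p \in [pchar K] -> in_prime_subfield p (- m%:R : K).
Proof.
move=> chp; have p_pr := pcharf_prime chp.
(* Vanishing in [K] and in ['F_p] both mean divisibility by [p], so the equation can be checked in
   ['F_p]. *)
exists (- m%:R : 'F_p); apply/esym/eqP; rewrite -addr_eq0 -natrD.
rewrite -(dvdn_pcharf chp) (dvdn_pcharf (pchar_Fp p_pr)) natrD.
by rewrite natr_Zp addNr.
Qed.

Lemma submod_closed_last_row_trace_space (K : fieldType) (n : nat) (a : K) :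
  submod_closed (last_row_trace_space n a).
Proof.
split=> [|c M N].
  rewrite inE mxtrace0 mxE mulr0 addr0 eqxx andbT.
  by apply/forallP => j; rewrite mxE eqxx implybT.
rewrite !inE => /andP[/forallP M0 /eqP trM] /andP[/forallP N0 /eqP trN].
apply/andP; split.
  apply/forallP => j; apply/implyP => nj; rewrite !mxE.
  by rewrite (eqP (implyP (M0 j) nj)) (eqP (implyP (N0 j) nj)) mulr0 addr0.
rewrite linearP /= !mxE mulrDr (mulrCA a) addrACA -mulrDr trM trN.
by rewrite mulr0 addr0.
Qed.

Lemma idempotent_last_row_trace_space_eq0 (K : fieldType) (n : nat) (a : K)
    (e : 'M[K]_n.+1) :
  (forall r, (r <= n)%N -> r%:R = 0 :> K -> r = 0%N) ->
  (forall r, (r <= n.+1)%N -> r%:R + a <> 0) ->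
  e * e = e -> e \in last_row_trace_space n a -> e = 0.
Proof.
move=> r_eq0 ra_neq0 ee; rewrite inE => /andP[/forallP e0 /eqP tr_e].
have rowE j : j != ord_max -> e ord_max j = 0 by move=> /(implyP (e0 j))/eqP.
move: tr_e; rewrite mxtrace_idempotent //.
(* Off the diagonal the last row is zero, so the corner entry of [e * e] is the square of that of
   [e]. *)
have : e ord_max ord_max * (e ord_max ord_max - 1) = 0.
  rewrite mulrBr mulr1 -[X in _ - X]/(e ord_max ord_max) -{3}ee.
  rewrite [X in _ - X]mxE (bigD1 ord_max) //= big1 ?addr0 ?subrr // => j nj.
  by rewrite rowE ?mul0r.
move/eqP; rewrite mulf_eq0 subr_eq0 => /orP[]/eqP enn; rewrite enn.
  rewrite mulr0 addr0 => /r_eq0 r0.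
  (* Now the whole last row is zero, so [e] has no right inverse and its rank is at most [n], as
     [r0] requires. *)
  apply/eqP; rewrite -mxrank_eq0 r0 // -ltnS ltn_neqAle rank_leq_row andbT.
  apply/negP => /row_freeP[B /(congr1 (fun M : 'M_n.+1 => M ord_max ord_max))].
  rewrite !mxE eqxx big1 => [/esym/eqP|j _]; first by rewrite oner_eq0.
  by have [->|nj] := eqVneq j ord_max; rewrite ?enn ?rowE ?mul0r.
by rewrite mulr1 => /ra_neq0 []; apply: rank_leq_row.
Qed.

(* The matrices have size n.+1, so n.+1 is the (positive) size of the paper. *)
Theorem proposition1p2 (n : nat) (K : fieldType) (p : nat)
  (charK : has_char K p)
  (p_large : p = 0%N \/ (n.+1 <= p)%N)
  (K_not_Fp : p = n.+1 \/ p = n.+2 -> ~ field_isomorphic K 'F_p)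
  (a : K)
  (a_generic : ~ (p = n.+1 \/ p = n.+2) -> a = 1)
  (a_special : p = n.+1 \/ p = n.+2 -> ~ in_prime_subfield p a) :
  two_sided_mathieu_subspace (last_row_trace_space n a).
Proof.
have closedM := submod_closed_last_row_trace_space n a.
split=> // A b c MA.
have [q [k [ee Ake]]] := fitting_idempotent A.
suff e0 : horner_mx A (q * 'X) = 0.
  exists k => m lekm; have [M0 _] := closedM.
  by rewrite -(subnK lekm) exprD -Ake e0 !mulr0 mul0r.
apply: (@idempotent_last_row_trace_space_eq0 _ _ a) => //; last first.
- exact: submod_horner_mx.
- move=> r ler /eqP; rewrite addrC addr_eq0 => /eqP aE.
  have [/orP special|/norP[/eqP pn1 /eqP pn2]] :=
    boolP ((p == n.+1) || (p == n.+2)).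
    have special' : p = n.+1 \/ p = n.+2 by case: special => /eqP; tauto.
    apply: (a_special special'); rewrite aE; apply: in_prime_subfield_oppr_nat.
    by case: charK => [[p0 _]|//]; case: special'; rewrite p0.
  have a1 : a = 1 by apply: a_generic => -[].
  (* Here [r.+1 <= n.+2], while a positive [p] exceeds [n.+2]: it is at least [n.+1] and differs
     from both [n.+1] and [n.+2]. *)
  have /eqP : r.+1%:R = 0 :> K by rewrite -natr1 -[X in _ + X]a1 aE subrr.
  rewrite (has_char_natr_eq0 charK) //; case: p_large => [|lenp]; first by left.
  right; apply: (leq_ltn_trans (ler : (r.+1 <= n.+2)%N)).
  by rewrite 2!ltn_neqAle lenp !(eq_sym _ p) andbT; apply/andP; split; apply/eqP.
move=> r ler /eqP; rewrite (has_char_natr_eq0 charK) => [/eqP //|].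
by case: p_large => [|lenp]; [left | right; apply: leq_trans lenp].
Qed.
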